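(* Let $f:\mathbb{R}^n\to\mathbb{R}$ be continuous and bounded, and suppose $f$ attains its minimum $\underline f:=\min_{z\in\mathbb{R}^n}f(z)$, so that $\mathfrak{M}:=\{x\in\mathbb{R}^n:f(x)=\underline f\}\neq\emptyset$. Let $\lambda>0$, $t\in(0,\infty)$, $x\in\mathbb{R}^n$, $\varepsilon>0$, let $y_x^{\alpha_\varepsilon}(\cdot)$ be an $\varepsilon$-optimal trajectory starting from $x$ for the finite-horizon discounted problem, and let $R:=\sqrt{6\|f\|_\infty}$. Then $$\mu_t^\lambda[x,\alpha_\varepsilon](\delta)\le\frac{\lambda}{1-e^{-\lambda t}}\left(\frac{R\,\operatorname{dist}(x,\mathfrak{M})+\varepsilon}{\delta}\right)\qquad\forall\,\delta>0.$$ In particular, for an optimal trajectory $y_x^{\alpha_*}(\cdot)$ (the case $\varepsilon=0$), $$\mu_t^\lambda[x,\alpha_*](\delta)\le\frac{\lambda}{1-e^{-\lambda t}}\,\frac{R\,\operatorname{dist}(x,\mathfrak{M})}{\delta}\qquad\forall\,\delta>0.$$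
   Context: $\|f\|_\infty=\sup|f|$. Fix a constant $M\ge1+\sqrt{6\|f\|_\infty}$ and let $B_M$ be the closed ball of radius $M$ centered at $0$ in $\mathbb{R}^n$. Admissible controls are measurable functions $\alpha(\cdot):[0,\infty)\to B_M$; the trajectory is $y_x^\alpha(s)=x+\int_0^s\alpha(r)\,dr$. The finite-horizon discounted problem has value function $$u_\lambda(x,t)=\inf_\alpha\int_0^t\Big(\tfrac12|\alpha(s)|^2+f(y_x^\alpha(s))\Big)e^{-\lambda s}\,ds.$$ For $\varepsilon\ge0$, a trajectory $y_x^{\alpha_\varepsilon}$ with admissible control $\alpha_\varepsilon$ is $\varepsilon$-optimal if $\int_0^t(\tfrac12|\alpha_\varepsilon(s)|^2+f(y_x^{\alpha_\varepsilon}(s)))e^{-\lambda s}\,ds\le u_\lambda(x,t)+\varepsilon$; it is optimal if this holds with $\varepsilon=0$. For $\delta\ge0$ let $K_\delta:=\{y\in\mathbb{R}^n:f(y)\le\underline f+\delta\}$ and $K_\delta^c=\mathbb{R}^n\setminus K_\delta$. The occupation measure is $$\mu_t^\lambda[x,\alpha](\delta):=\frac{\lambda}{1-e^{-\lambda t}}\int_0^t\mathbf{1}_{K_\delta^c}(y_x^\alpha(s))\,e^{-\lambda s}\,ds.$$ $\operatorname{dist}(x,\mathfrak{M})=\inf_{z\in\mathfrak{M}}|x-z|$. *)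

(* Defs.v *)
From mathcomp Require Import all_boot all_order all_algebra.
From mathcomp Require Import all_classical all_reals all_analysis.
Import Order.TTheory GRing.Theory Num.Theory.
Import numFieldNormedType.Exports.

Set Implicit Arguments.
Unset Strict Implicit.
Unset Printing Implicit Defensive.

Local Open Scope classical_set_scope.
Local Open Scope ring_scope.

(* The real line with its Lebesgue-measurable sets, i.e. the domain of
   [completed_lebesgue_measure]; [measurableTypeR R] only has the Borel sets. *)
Notation lebesgueTypeR R := (caratheodory_type (@wlength R idfun)^*%mu).

Section OptimalControl.
Context {R : realType} {n : nat}.
Implicit Types (f : 'rV[R]_n -> R) (a : R -> 'rV[R]_n) (x y z : 'rV[R]_n).

(* The norm that the library puts on row vectors is the sup norm. *)
Definition enorm x : R := Num.sqrt (\sum_(i < n) x 0 i ^+ 2).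

Definition edist_set x (A : set 'rV[R]_n) : R :=
  inf [set enorm (x - z) | z in A].

Definition sup_norm f : R := sup [set `|f z| | z in [set: 'rV[R]_n]].

(* The minimum of [f] when it is attained. *)
Definition min_val f : R := inf (range f).

Definition argmin_set f : set 'rV[R]_n := [set z | f z = min_val f].

Definition sublevel f (delta : R) : set 'rV[R]_n :=
  [set y | f y <= min_val f + delta].

(* Controls are only constrained on [0, +oo[; their values at negative times
   are irrelevant. *)
Definition admissible (M : R) a : Prop :=
  (forall i : 'I_n, measurable_fun (`[0, +oo[ : set (lebesgueTypeR R))
     (fun s : lebesgueTypeR R => a s 0 i : measurableTypeR R)) /\
  (forall s : R, 0 <= s -> enorm (a s) <= M).

Definition trajectory x a (s : R) : 'rV[R]_n :=
  x + \row_(i < n) \int[completed_lebesgue_measure]_(r in `[0, s]) (a r 0 i).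

Definition cost f (lambda : R) x (t : R) a : R :=
  \int[completed_lebesgue_measure]_(s in `[0, t])
    ((2^-1 * enorm (a s) ^+ 2 + f (trajectory x a s)) * expR (- (lambda * s))).

Definition value_fun (M : R) f (lambda : R) x (t : R) : R :=
  inf [set cost f lambda x t a | a in admissible M].

Definition eps_optimal (M : R) f (lambda : R) x (t eps : R) a : Prop :=
  admissible M a /\ cost f lambda x t a <= value_fun M f lambda x t + eps.

Definition occupation f (lambda t : R) x a (delta : R) : R :=
  lambda / (1 - expR (- (lambda * t))) *
  \int[completed_lebesgue_measure]_(s in `[0, t])
    (\1_(~` sublevel f delta) (trajectory x a s) * expR (- (lambda * s))).

End OptimalControl.

(* Main.v *)
Require Import Defs.
From mathcomp Require Import all_boot all_order all_algebra.
From mathcomp Require Import all_classical all_reals all_analysis.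
From mathcomp Require Import measurable_realfun lra.
Import Order.TTheory GRing.Theory Num.Theory.
Import numFieldNormedType.Exports.

Local Open Scope classical_set_scope.
Local Open Scope ring_scope.

(** Write [C] for the integral of [expR (- (lambda * s))] over [[0, t]], so
    that [min_val f * C] is the cost of resting on a minimizer during the whole
    horizon.  The proof squeezes the cost of an [eps]-optimal control between
    two quantities of the form [min_val f * C + excess].

    From below, the kinetic term is nonnegative and [f] exceeds its minimum by
    at least [delta] whenever the trajectory is outside [sublevel f delta]; so
    the cost of any control is at least [min_val f * C] plus [delta] times the
    discounted time spent outside ([cost_ge_occupation]).

    From above, pick a minimizer [z] and let [d] be its distance to [x].  Going
    straight to [z] at constant speed [r] and resting there has an excess cost
    only during the travel time [d / r], at a rate of at most
    [r ^+ 2 / 2 + 2 * sup_norm f] ([cost_dash]).  With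
    [r ^+ 2 = 6 * sup_norm f] this rate is at most [r ^+ 2], so the value is at
    most [min_val f * C + r * d] ([value_fun_le]).  If [sup_norm f = 0] there
    is no positive speed to travel at, but then [x] itself is a minimizer and
    resting at [x] is good enough ([value_fun_le_stay]).

    Comparing the two bounds cancels [min_val f * C]; the infimum over [z] then
    turns [d] into the distance to the set of minimizers
    ([occupation_time_le]).

    The analytic side conditions are about integrability: a trajectory is
    Lipschitz because its control is bounded, hence [f] along it is continuous,
    and every integrand met here is measurable and bounded on [[0, t]]. *)

(** * Integration over intervals for the completed Lebesgue measure *)

Section LebesgueLine.
Context {R : realType}.
Local Notation mu := (@completed_lebesgue_measure R).
Local Notation lebT := (lebesgueTypeR R).

Lemma measurable_itv_lebesgue (i : interval R) :
  measurable ([set` i] : set lebT).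
Proof. by apply: sub_caratheodory; exact: measurable_itv. Qed.

(** The Lebesgue measure and its completion restrict the same outer measure, so
    they agree on intervals by conversion. *)
Lemma completed_lebesgue_measure_itv (i : interval R) :
  mu ([set` i] : set R) =
  (if i.1 < i.2 then (i.2 : \bar R) - i.1 else 0)%E.
Proof. exact: lebesgue_measure_itv. Qed.

Lemma fine_mu_itv (b0 b1 : bool) (u v : R) : u <= v ->
  fine (mu [set` Interval (BSide b0 u) (BSide b1 v)]) = v - u.
Proof.
move=> uv; rewrite completed_lebesgue_measure_itv/= lte_fin.
by case: (ltgtP u v) uv => [| |->]//; rewrite subrr.
Qed.

Lemma mu_itv_lty (b0 b1 : bool) (u v : R) :
  (mu [set` Interval (BSide b0 u) (BSide b1 v)] < +oo)%E.
Proof.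
by rewrite completed_lebesgue_measure_itv/=; case: ifP => _;
  rewrite -?EFinB ltry.
Qed.

(** Borel sets are Caratheodory measurable: enlarging the sigma-algebra of the
    source keeps a Borel function measurable. *)
Lemma continuous_measurable_lebesgue (D : set lebT) (g : R -> R) :
  measurable D -> continuous g ->
  measurable_fun D (g : lebT -> measurableTypeR R).
Proof.
move=> mD /continuous_measurable_fun mg _ B mB.
apply: measurableI => //; apply: sub_caratheodory.
by rewrite -[X in measurable X]setTI; exact: mg.
Qed.

Lemma bounded_integrable_itv (u v C : R) (g : lebT -> measurableTypeR R) :
  measurable_fun (`[u, v] : set lebT) g ->
  (forall s, u <= s <= v -> `|g s| <= C) ->
  mu.-integrable (`[u, v] : set lebT) (EFin \o g).
Proof.
move=> mg gC; apply: measurable_bounded_integrable => //.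
- exact: measurable_itv_lebesgue.
- exact: mu_itv_lty.
- exists C; split; first exact: num_real.
  move=> D CD s /=; rewrite in_itv/= => us; exact: le_trans (gC _ us) (ltW CD).
Qed.

Lemma integrableZl_EFin (D : set lebT) (k : R) (g : lebT -> measurableTypeR R) :
  measurable D -> mu.-integrable D (EFin \o g) ->
  mu.-integrable D (EFin \o (fun s => k * g s)).
Proof. by move=> mD ig; exact: (integrableZl mD k ig). Qed.

Lemma integrableD_EFin (D : set lebT) (g h : lebT -> measurableTypeR R) :
  measurable D -> mu.-integrable D (EFin \o g) ->
  mu.-integrable D (EFin \o h) ->
  mu.-integrable D (EFin \o (fun s => g s + h s)).
Proof. by move=> mD ig ih; exact: (integrableD mD ig ih). Qed.

(** The difference of the two integrals is the integral over the half-open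
    interval between the endpoints, where the integrand is at most [C]. *)
Lemma Rintegral0_lipschitz (C : R) (g : lebT -> measurableTypeR R) (s s' : R) :
  measurable_fun (`[0, +oo[ : set lebT) g ->
  (forall r, 0 <= r -> `|g r| <= C) -> 0 <= s -> s <= s' ->
  `|\int[mu]_(r in `[0, s']) g r - \int[mu]_(r in `[0, s]) g r| <= C * (s' - s).
Proof.
move=> mg gC s0 ss'.
have mI (i : interval R) := measurable_itv_lebesgue i.
have ig : mu.-integrable (`[0, s'] : set lebT) (EFin \o g).
  apply: (@bounded_integrable_itv _ _ C).
  - apply: measurable_funS mg => //.
    by apply: subset_itvl; rewrite bnd_simp.
  - by move=> r /andP[+ _]; exact: gC.
have E : `[0, s']%classic = `[0, s] `|` `]s, s'] :> set lebT.
  by rewrite -itv_bndbnd_setU ?bnd_simp.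
rewrite E Rintegral_setU//; [|by rewrite -E|]; last first.
  apply/disj_setPS => r [/=]; rewrite !in_itv/= => /andP[_ rs] /andP[sr _].
  by move: (lt_le_trans sr rs); rewrite ltxx.
rewrite addrC addKr.
have ig' : mu.-integrable (`]s, s'] : set lebT) (EFin \o g).
  by apply: integrableS ig; rewrite ?E//; apply: measurableU.
apply: le_trans (le_normr_Rintegral (mI _) ig') _.
rewrite -[s' - s](@fine_mu_itv false false)// -Rintegral_cst; last exact: mI.
apply: le_Rintegral => //.
- exact: integrable_norm.
- apply: measurable_bounded_integrable => //; first exact: mu_itv_lty.
  exists C; split; first exact: num_real.
  move=> D CD r /=; rewrite in_itv/= => /andP[sr _].
  apply: le_trans _ (ltW CD); rewrite ger0_norm//.
  by apply: le_trans (gC s s0).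
- move=> r /=; rewrite in_itv/= => /andP[sr _]; apply: gC.
  by apply: le_trans (ltW sr).
Qed.

End LebesgueLine.

(** * The Euclidean norm *)

Section Enorm.
Context {R : realType} {n : nat}.
Implicit Types x : 'rV[R]_n.

Lemma enorm_ge0 x : 0 <= enorm x. Proof. exact: sqrtr_ge0. Qed.

Lemma sqr_enorm x : enorm x ^+ 2 = \sum_(i < n) x 0 i ^+ 2.
Proof. by rewrite sqr_sqrtr//; apply: sumr_ge0 => i _; exact: sqr_ge0. Qed.

Lemma coord_le_enorm x i : `|x 0 i| <= enorm x.
Proof.
rewrite -(ler_pXn2r (n:=2))// ?nnegrE ?enorm_ge0//.
rewrite sqr_enorm real_normK ?num_real//.
by rewrite (bigD1 i)//= lerDl; apply: sumr_ge0 => j _; exact: sqr_ge0.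
Qed.

Lemma enorm0 : enorm (0 : 'rV[R]_n) = 0.
Proof.
by apply/eqP; rewrite -sqrf_eq0 sqr_enorm big1// => i _; rewrite mxE expr0n.
Qed.

Lemma enorm_eq0 x : enorm x = 0 -> x = 0.
Proof.
move=> x0; apply/rowP => i; rewrite mxE; apply/normr0_eq0/eqP.
by rewrite eq_le normr_ge0 andbT -x0 coord_le_enorm.
Qed.

Lemma enormZ (k : R) x : 0 <= k -> enorm (k *: x) = k * enorm x.
Proof.
move=> k0; apply/eqP; rewrite -(eqrXn2 (n:=2))// ?mulr_ge0 ?enorm_ge0//.
rewrite exprMn !sqr_enorm mulr_sumr; apply/eqP/eq_bigr => i _.
by rewrite mxE exprMn.
Qed.

Lemma enormN x : enorm (- x) = enorm x.
Proof.
by rewrite /enorm; congr Num.sqrt; apply: eq_bigr => i _; rewrite mxE sqrrN.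
Qed.

End Enorm.

(** * Regularity of trajectories and of the running cost *)

Section Trajectory.
Context {R : realType} {n : nat}.
Local Notation mu := (@completed_lebesgue_measure R).
Local Notation lebT := (lebesgueTypeR R).
Implicit Types (x : 'rV[R]_n) (a : R -> 'rV[R]_n).

Lemma admissible_ge0 M a : admissible M a -> 0 <= M.
Proof. by case=> _ /(_ 0 (lexx 0)); apply: le_trans; exact: enorm_ge0. Qed.

Lemma admissible_integrable_coord M a s i : admissible M a ->
  mu.-integrable (`[0, s] : set lebT)
    (EFin \o (fun r => a r 0 i : measurableTypeR R)).
Proof.
move=> [ma aM]; apply: (@bounded_integrable_itv _ _ _ M).
  apply: measurable_funS (ma i) => //; first exact: measurable_itv_lebesgue.
  by apply: subset_itvl; rewrite bnd_simp.
by move=> r /andP[r0 _]; apply: le_trans (coord_le_enorm _ _) (aM _ r0).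
Qed.

Lemma norm_rV_le (y : 'rV[R]_n) (C : R) : 0 <= C ->
  (forall i, `|y 0 i| <= C) -> `|y| <= C.
Proof.
move=> C0 yC; rewrite /Num.norm/= mx_normrE; apply: bigmax_le => // -[j i] _ /=.
by rewrite (ord1 j).
Qed.

Lemma trajectory_lipschitz M x a s s' : admissible M a -> 0 <= s -> 0 <= s' ->
  `|trajectory x a s - trajectory x a s'| <= M * `|s - s'|.
Proof.
move=> aadm; have M0 := admissible_ge0 _ _ aadm.
wlog ss' : s s' / s <= s' => [hw s0 s'0|s0 _].
  have [ss'|/ltW s's] := leP s s'; first exact: hw.
  by rewrite distrC [`|s - s'|]distrC; exact: hw.
apply: norm_rV_le => [|i]; first by rewrite mulr_ge0.
case: aadm => ma aM; rewrite /trajectory !mxE opprD addrACA subrr add0r.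
rewrite distrC [`|s - s'|]distrC (@ger0_norm _ (s' - s)) ?subr_ge0//.
apply: (Rintegral0_lipschitz M
  (fun r => a r 0 i : measurableTypeR R)) => // r r0.
exact: le_trans (coord_le_enorm _ _) (aM _ r0).
Qed.

(** Composing with [Num.max 0] extends the trajectory from the half-line, where
    it is Lipschitz, to a continuous function on the whole line; this avoids
    working with the subspace topology of an interval. *)
Lemma trajectory_continuous M x a : admissible M a ->
  continuous (fun s : R => trajectory x a (Num.max 0 s)).
Proof.
move=> aadm s; have M0 := admissible_ge0 _ _ aadm.
apply/cvgrPdist_le => /= e e0; near=> s'.
apply: le_trans (trajectory_lipschitz _ _ _ _ _ aadm _ _) _;
  rewrite ?le_max ?lexx//.
have : `|s - s'| <= e / (M + 1).
  by near: s'; apply: cvgr_dist_le => //; rewrite divr_gt0// ltr_wpDl.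
rewrite ler_pdivlMr ?ltr_wpDl// => ss'; apply: le_trans ss'.
rewrite mulrC ler_pM// ?lerDl//.
(* [Num.max 0] is 1-Lipschitz. *)
have := ler_norm (s - s'); have := ler_norm (s' - s); rewrite distrC ler_norml.
by case: (leP 0 s) => s0; case: (leP 0 s') => s'0 h1 h2; apply/andP; split; lra.
Unshelve. all: by end_near. Qed.

Lemma measurable_along_trajectory M x a (f : 'rV[R]_n -> R) t :
  continuous f -> admissible M a ->
  measurable_fun (`[0, t] : set lebT)
    (fun s => f (trajectory x a s) : measurableTypeR R).
Proof.
move=> cf aadm; have mI := measurable_itv_lebesgue `[0, t].
apply: (@eq_measurable_fun _ _ lebT (measurableTypeR R) _
  (fun s : lebT => f (trajectory x a (Num.max 0 s)) : measurableTypeR R)).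
  move=> s; rewrite inE/= in_itv/= => /andP[s0 _].
  by rewrite max_r.
apply: continuous_measurable_lebesgue => // s.
apply: continuous_comp; [exact: (trajectory_continuous M)|exact: cf].
Qed.

Lemma measurable_sqr_enorm M a t : admissible M a ->
  measurable_fun (`[0, t] : set lebT)
    (fun s => enorm (a s) ^+ 2 : measurableTypeR R).
Proof.
move=> [ma _].
rewrite (_ : (fun s => _) = (fun s => \sum_(i < n) a s 0 i ^+ 2)); last first.
  by apply/funext => s; exact: sqr_enorm.
apply: measurable_sum => i; apply: measurable_funX.
apply: measurable_funS (ma i) => //; first exact: measurable_itv_lebesgue.
by apply: subset_itvl; rewrite bnd_simp.
Qed.

Lemma measurable_discount (lambda : R) (D : set lebT) : measurable D ->
  measurable_fun D (fun s => expR (- (lambda * s)) : measurableTypeR R).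
Proof.
move=> mD; apply: continuous_measurable_lebesgue => // s.
apply: continuous_comp; last exact: continuous_expR.
by apply: cvgN; apply: cvgM; [exact: cvg_cst|exact: cvg_id].
Qed.

Lemma discount_le1 (lambda s : R) : 0 < lambda -> 0 <= s ->
  expR (- (lambda * s)) <= 1.
Proof. by move=> l0 s0; rewrite -expR0 ler_expR oppr_le0 mulr_ge0// ltW. Qed.

Lemma integrable_discount (lambda t : R) : 0 < lambda ->
  mu.-integrable (`[0, t] : set lebT)
    (EFin \o (fun s => expR (- (lambda * s)))).
Proof.
move=> l0; apply: (@bounded_integrable_itv _ _ _ 1) => [|s /andP[s0 _]].
  by apply: measurable_discount; exact: measurable_itv_lebesgue.
by rewrite ger0_norm ?expR_ge0// discount_le1.
Qed.

Lemma integrable_discounted (lambda t C : R) (g : lebT -> measurableTypeR R) :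
  0 < lambda -> measurable_fun (`[0, t] : set lebT) g ->
  (forall s, 0 <= s <= t -> `|g s| <= C) ->
  mu.-integrable (`[0, t] : set lebT)
    (EFin \o (fun s => g s * expR (- (lambda * s)) : measurableTypeR R)).
Proof.
move=> l0 mg gC.
apply: (@bounded_integrable_itv _ _ _ C).
  apply: measurable_funM; first exact: mg.
  by apply: measurable_discount; exact: measurable_itv_lebesgue.
move=> s st; rewrite normrM (ger0_norm (expR_ge0 _)).
apply: le_trans (gC _ st); rewrite ler_piMr// discount_le1//.
by case/andP: st.
Qed.

Lemma integrable_running_cost M (f : 'rV[R]_n -> R) F lambda x t a :
  continuous f -> (forall z, `|f z| <= F) -> 0 < lambda -> admissible M a ->
  mu.-integrable (`[0, t] : set lebT)
    (EFin \o (fun s => (2^-1 * enorm (a s) ^+ 2 + f (trajectory x a s)) *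
                       expR (- (lambda * s)) : measurableTypeR R)).
Proof.
move=> cf fF l0 aadm.
apply: (@integrable_discounted _ _ (2^-1 * M ^+ 2 + F)); first exact: l0.
  apply: measurable_funD; last exact: (measurable_along_trajectory M).
  by apply: measurable_funM;
    [exact: measurable_cst|exact: (measurable_sqr_enorm M)].
move=> s /andP[s0 _]; apply: le_trans (ler_normD _ _) _; apply: lerD => //.
rewrite ger0_norm; last by rewrite mulr_ge0 ?sqr_ge0// invr_ge0.
rewrite ler_wpM2l ?invr_ge0//.
rewrite ler_pXn2r ?nnegrE ?enorm_ge0 ?(admissible_ge0 _ _ aadm)//.
by case: aadm => _; exact.
Qed.

End Trajectory.

(** * The control that moves with constant velocity and then stops *)

Section Dash.
Context {R : realType} {n : nat}.
Local Notation mu := (@completed_lebesgue_measure R).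
Local Notation lebT := (lebesgueTypeR R).
Implicit Types (x c : 'rV[R]_n) (tau : R).

Definition dash c tau (s : R) : 'rV[R]_n := if s < tau then c else 0.

Lemma dash_admissible M c tau :
  0 <= M -> enorm c <= M -> admissible M (dash c tau).
Proof.
move=> M0 cM; split=> [i|s s0]; last by rewrite /dash; case: ifP; rewrite ?enorm0.
have -> : (fun s : lebT => dash c tau s 0 i : measurableTypeR R) =
          (fun s => c 0 i * \1_(`]-oo, tau[%classic : set lebT) s).
  apply/funext => s; rewrite /dash indicE mem_setE in_itv/=.
  by case: ifP; rewrite ?mulr1// mxE mulr0.
apply: measurable_funM; first exact: measurable_cst.
by apply: measurable_indic; exact: measurable_itv_lebesgue.
Qed.

Lemma trajectory_dash x c tau s : 0 <= tau -> tau <= s ->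
  trajectory x (dash c tau) s = x + tau *: c.
Proof.
move=> t0 ts; congr (_ + _); apply/rowP => i; rewrite !mxE.
have mI (j : interval R) := measurable_itv_lebesgue j.
have ad : admissible (enorm c) (dash c tau).
  by apply: dash_admissible => //; exact: enorm_ge0.
have E : `[0, s]%classic = `[0, tau[ `|` `[tau, s] :> set lebT.
  by rewrite -itv_bndbnd_setU ?bnd_simp.
rewrite E Rintegral_setU//; last 2 first.
- by rewrite -E; exact: (admissible_integrable_coord (enorm c)).
- apply/disj_setPS => r [/=]; rewrite !in_itv/= => /andP[_ rs] /andP[sr _].
  by move: (lt_le_trans rs sr); rewrite ltxx.
rewrite (@eq_Rintegral _ _ _ _ _ (fun=> c 0 i)); last first.
  by move=> r; rewrite inE/= in_itv/= => /andP[_ rt]; rewrite /dash rt.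
rewrite [X in _ + X](@eq_Rintegral _ _ _ _ _ (fun=> 0)); last first.
  by move=> r; rewrite inE/= in_itv/= => /andP[tr _]; rewrite /dash ltNge tr mxE.
by rewrite !Rintegral_cst// mul0r addr0 fine_mu_itv// subr0 mulrC.
Qed.

End Dash.

(** * Bounds on the cost and on the value *)

Section Costs.
Context {R : realType} {n : nat}.
Local Notation mu := (@completed_lebesgue_measure R).
Local Notation lebT := (lebesgueTypeR R).
Variables (f : 'rV[R]_n -> R) (F M lambda : R).
Hypotheses (f_cont : continuous f) (f_le : forall z, `|f z| <= F).
Hypothesis (lambda_gt0 : 0 < lambda).
Hypothesis (f_min : forall z, min_val f <= f z).

(** The indicator factors through [f] as the indicator of a half-line, which is
    a Borel function of the real variable [f (trajectory x a s)]. *)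
Lemma measurable_occupation_indic x a t delta : admissible M a ->
  measurable_fun (`[0, t] : set lebT)
    (fun s => \1_(~` sublevel f delta) (trajectory x a s) : measurableTypeR R).
Proof.
move=> aadm.
have -> : ~` sublevel f delta = f @^-1` `]min_val f + delta, +oo[.
  by apply/seteqP; split=> z /=; rewrite /sublevel/= in_itv/= andbT ltNge => /negP.
apply: (@measurableT_comp _ _ _ _ _ _
  (\1_(`]min_val f + delta, +oo[) : measurableTypeR R -> measurableTypeR R)).
  by apply: measurable_indic; exact: measurable_itv.
exact: (measurable_along_trajectory M).
Qed.

(** Holds pointwise under the integral: drop the kinetic term, and bound [f]
    below by [min_val f + delta] outside the sublevel set and by [min_val f]
    inside. *)
Lemma cost_ge_occupation x a t delta : admissible M a -> 0 <= delta ->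
  min_val f * (\int[mu]_(s in `[0, t]) expR (- (lambda * s))) +
  delta * (\int[mu]_(s in `[0, t])
             (\1_(~` sublevel f delta) (trajectory x a s) *
              expR (- (lambda * s))))
  <= cost f lambda x t a.
Proof.
move=> aadm d0; have mI := measurable_itv_lebesgue `[0, t].
have ie := integrable_discount lambda t lambda_gt0.
have ii : mu.-integrable (`[0, t] : set lebT)
    (EFin \o (fun s => \1_(~` sublevel f delta) (trajectory x a s) *
              expR (- (lambda * s)))).
  apply: (@integrable_discounted _ _ _ 1); first exact: lambda_gt0.
    exact: measurable_occupation_indic.
  by move=> s _; rewrite indicE; case: (_ \in _); rewrite ?normr1 ?normr0.
rewrite -!RintegralZl// -RintegralD//; last 2 first.
- exact: integrableZl_EFin.
- exact: integrableZl_EFin.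
apply: le_Rintegral => //.
- by apply: integrableD_EFin => //; exact: integrableZl_EFin.
- exact: (integrable_running_cost M _ F).
move=> s _; rewrite mulrA -mulrDl ler_wpM2r ?expR_ge0// indicE.
have c0 : 0 <= 2^-1 * enorm (a s) ^+ 2 by rewrite mulr_ge0 ?sqr_ge0 ?invr_ge0.
have [|] := boolP (_ \in _).
  rewrite inE /sublevel/= => /negP; rewrite -ltNge => /ltW fd.
  by rewrite mulr1 (le_trans fd)// lerDr.
move=> _; rewrite mulr0 addr0.
by apply: le_trans (f_min (trajectory x a s)) _; rewrite lerDr.
Qed.

(** Before [tau] the running cost exceeds [min_val f] by at most the kinetic
    term plus the oscillation [2 * F] of [f]; from [tau] on, the trajectory
    rests at the minimizer [z] and there is no excess. *)
Lemma cost_dash x c tau t z :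
  0 <= tau -> 0 <= t -> x + tau *: c = z -> f z = min_val f ->
  cost f lambda x t (dash c tau) <=
  min_val f * (\int[mu]_(s in `[0, t]) expR (- (lambda * s))) +
  (2^-1 * enorm c ^+ 2 + 2 * F) * tau.
Proof.
move=> tau0 t0 xz fz; have mI (j : interval R) := measurable_itv_lebesgue j.
set K := _ + 2 * F.
have F0 : 0 <= F by exact: le_trans (f_le 0).
have c0 : 0 <= 2^-1 * enorm c ^+ 2 by rewrite mulr_ge0 ?sqr_ge0 ?invr_ge0.
have K0 : 0 <= K by rewrite addr_ge0// mulr_ge0.
have ad : admissible (enorm c) (dash c tau).
  by apply: dash_admissible => //; exact: enorm_ge0.
have ie := integrable_discount lambda t lambda_gt0.
have ii : mu.-integrable (`[0, t] : set lebT)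
    (EFin \o \1_(`[0, tau[%classic : set lebT)).
  apply: (@bounded_integrable_itv _ _ _ 1); first exact: measurable_indic.
  by move=> s _; rewrite indicE; case: (_ \in _); rewrite ?normr1 ?normr0.
have i1 : \int[mu]_(s in `[0, t]) \1_(`[0, tau[%classic : set lebT) s <= tau.
  rewrite /Rintegral integral_indic//.
  rewrite -[leRHS]subr0 -[leRHS](@fine_mu_itv _ true true)// fine_le//.
  - rewrite ge0_fin_numE//; apply: le_lt_trans (mu_itv_lty true false 0 t).
    by rewrite le_measure ?inE//; exact: measurableI.
  - by rewrite ge0_fin_numE// mu_itv_lty.
  - by rewrite le_measure ?inE//; exact: measurableI.
apply: (@le_trans _ _ (\int[mu]_(s in `[0, t])
   (min_val f * expR (- (lambda * s)) +
    K * \1_(`[0, tau[%classic : set lebT) s))).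
  apply: le_Rintegral => //.
  - exact: (integrable_running_cost (enorm c) _ F).
  - by apply: integrableD_EFin => //; exact: integrableZl_EFin.
  move=> s /=; rewrite in_itv/= => /andP[s0 _].
  rewrite indicE mem_setE in_itv/= s0/=.
  have [st|ts] := ltP s tau.
    rewrite /dash st mulr1 -lerBlDl -mulrBl.
    apply: le_trans (_ : K * expR (- (lambda * s)) <= K); last first.
      by rewrite ler_piMr// discount_le1.
    rewrite ler_wpM2r ?expR_ge0// -addrA lerD2l.
    have := f_le (trajectory x (dash c tau) s); have := f_le z.
    rewrite -fz !ler_norml.
    by move=> /andP[? ?] /andP[? ?]; lra.
  rewrite trajectory_dash// xz fz /dash ltNge ts/= enorm0 expr0n/= mulr0 add0r.
  by rewrite mulr0 addr0.
rewrite RintegralD//; last 2 first.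
- exact: integrableZl_EFin.
- exact: integrableZl_EFin.
by rewrite !RintegralZl// lerD2l ler_wpM2l.
Qed.

Lemma cost_has_lbound x t :
  has_lbound [set cost f lambda x t a | a in admissible M].
Proof.
exists (min_val f * (\int[mu]_(s in `[0, t]) expR (- (lambda * s)))).
move=> _ [a aadm <-].
have := cost_ge_occupation x a t 0 aadm (lexx 0).
by rewrite mul0r addr0.
Qed.

(** The dash to [z] at speed [r = Num.sqrt (6 * F)] takes the time [d / r] and
    has an excess rate of at most [r ^+ 2 / 2 + 2 * F = 5 / 6 * r ^+ 2], hence an excess
    cost of at most [r * d]. *)
Lemma value_fun_le x t z : 0 < F -> Num.sqrt (6 * F) <= M -> 0 <= t ->
  f z = min_val f ->
  value_fun M f lambda x t <=
  min_val f * (\int[mu]_(s in `[0, t]) expR (- (lambda * s))) +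
  Num.sqrt (6 * F) * enorm (x - z).
Proof.
move=> F0 rM t0 fz; set r := Num.sqrt _ in rM *.
have r0 : 0 < r by rewrite sqrtr_gt0 mulr_gt0.
have rr : r ^+ 2 = 6 * F by rewrite sqr_sqrtr// mulr_ge0// ltW.
set d := enorm (x - z); have d0 : 0 <= d := enorm_ge0 _.
(* If [d = 0] then the convention [0^-1 = 0] makes this velocity zero. *)
pose c := (r / d) *: (z - x).
have cr : enorm c <= r.
  rewrite enormZ ?divr_ge0// ?(ltW r0)// -enormN opprB -/d.
  have [->|dn] := eqVneq d 0; first by rewrite mulr0 ltW.
  by rewrite divfK.
have cE : x + (d / r) *: c = z.
  rewrite /c scalerA; have [dz|dn] := eqVneq d 0.
    by have /enorm_eq0/subr0_eq -> := dz; rewrite subrr scaler0 addr0.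
  have -> : d / r * (r / d) = 1 by rewrite mulrA divfK ?gt_eqF// divff.
  by rewrite scale1r addrC subrK.
apply: (@le_trans _ _ (cost f lambda x t (dash c (d / r)))).
  apply: ge_inf; first exact: cost_has_lbound.
  exists (dash c (d / r)); last exact: erefl.
  apply: dash_admissible; last exact: le_trans rM.
  exact: le_trans (ltW r0) rM.
have dr0 : 0 <= d / r by rewrite divr_ge0// ltW.
apply: le_trans (cost_dash _ _ _ _ _ dr0 t0 cE fz) _; rewrite lerD2l.
have c2 : enorm c ^+ 2 <= r ^+ 2 by rewrite ler_pXn2r ?nnegrE ?enorm_ge0// ltW.
apply: (@le_trans _ _ (r ^+ 2 * (d / r))).
  by rewrite ler_wpM2r//; lra.
by rewrite expr2 -mulrA [d / r]mulrC mulVKf ?gt_eqF.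
Qed.

(** Replaces [value_fun_le] when [F = 0], where the travel speed vanishes. *)
Lemma value_fun_le_stay x t : 0 <= M -> 0 <= t -> f x = min_val f ->
  value_fun M f lambda x t <=
  min_val f * (\int[mu]_(s in `[0, t]) expR (- (lambda * s))).
Proof.
move=> M0 t0 fx; apply: (@le_trans _ _ (cost f lambda x t (dash 0 0))).
  apply: ge_inf; first exact: cost_has_lbound.
  exists (dash 0 0); last exact: erefl.
  by apply: dash_admissible; rewrite ?enorm0.
have := cost_dash x 0 0 t x (lexx 0) t0; rewrite scaler0 addr0 => /(_ erefl fx).
by rewrite mulr0 addr0.
Qed.

End Costs.

(** * The occupation estimate *)

Section SupNorm.
Context {R : realType} {n : nat}.
Implicit Types f : 'rV[R]_n -> R.

Lemma norm_le_sup_norm f : bounded_fun f -> forall z, `|f z| <= sup_norm f.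
Proof.
move=> [C [_ fC]] z; apply: sup_ubound; last by exists z.
exists (C + 1) => _ [y _ <-]; by apply: fC => //; rewrite ltrDl.
Qed.

Lemma min_val_le f : bounded_fun f -> forall z, min_val f <= f z.
Proof.
move=> /norm_le_sup_norm fF z; apply: ge_inf; last by exists z.
by exists (- sup_norm f) => _ [y _ <-]; have := fF y; rewrite ler_norml => /andP[].
Qed.

Lemma minimizer_in_argmin_set f z : bounded_fun f -> (forall y, f z <= f y) ->
  argmin_set f z.
Proof.
move=> fb fz; apply/eqP; rewrite eq_le min_val_le// andbT.
by apply: lb_le_inf; [exists (f z); exists z | move=> _ [y _ <-]].
Qed.

End SupNorm.

(** Both bounds on the cost contain [min_val f * C]; subtracting them leaves the
    occupation time, weighted by [delta], on one side and the excess cost of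
    travelling to a minimizer on the other. *)
Lemma occupation_time_le (R : realType) (n : nat) (f : 'rV[R]_n -> R)
    (M lambda t eps delta : R) (x : 'rV[R]_n) a :
  continuous f -> bounded_fun f -> (exists z, forall y, f z <= f y) ->
  Num.sqrt (6 * sup_norm f) <= M -> 0 < lambda -> 0 <= t -> 0 <= delta ->
  eps_optimal M f lambda x t eps a ->
  delta * (\int[completed_lebesgue_measure]_(s in `[0, t])
             (\1_(~` sublevel f delta) (trajectory x a s) *
              expR (- (lambda * s)))) <=
  Num.sqrt (6 * sup_norm f) * edist_set x (argmin_set f) + eps.
Proof.
move=> cf fb [z0 z0min] rM l0 t0 d0 [aadm aopt].
have fF := norm_le_sup_norm _ fb; have fmin := min_val_le _ fb.
have argz0 := minimizer_in_argmin_set _ _ fb z0min.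
set I := Rintegral _ _ _; set r := Num.sqrt _ in rM *.
set C :=
  \int[@completed_lebesgue_measure R]_(s in `[0, t]) expR (- (lambda * s)).
have low : min_val f * C + delta * I <= value_fun M f lambda x t + eps.
  by apply: le_trans aopt; exact: (cost_ge_occupation f (sup_norm f) M).
suff : value_fun M f lambda x t <=
    min_val f * C + r * edist_set x (argmin_set f) by lra.
have F0 : 0 <= sup_norm f by exact: le_trans (fF 0).
have [F_eq0|F_neq0] := eqVneq (sup_norm f) 0.
  have f0 y : f y = 0 by apply/normr0_eq0/eqP; rewrite eq_le normr_ge0 -F_eq0 fF.
  rewrite /r F_eq0 mulr0 sqrtr0 mul0r addr0.
  apply: (value_fun_le_stay f (sup_norm f)) => //; first exact: admissible_ge0 aadm.
  by apply: (minimizer_in_argmin_set f) => // y; rewrite !f0.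
have F_gt0 : 0 < sup_norm f by rewrite lt_def F_neq0.
have r0 : 0 < r by rewrite sqrtr_gt0 mulr_gt0.
rewrite -lerBlDl [r * _]mulrC -ler_pdivrMr//; apply: lb_le_inf.
  by exists (enorm (x - z0)); exists z0.
move=> _ [z fz <-]; rewrite ler_pdivrMr// [_ * r]mulrC lerBlDl.
exact: value_fun_le.
Qed.

Theorem theorem3p1 (R : realType) (n : nat) (f : 'rV[R]_n -> R)
    (f_cont : continuous f)
    (f_bounded : bounded_fun f)
    (f_min : exists z, forall y, f z <= f y)
    (M : R) (M_ge : 1 + Num.sqrt (6 * sup_norm f) <= M)
    (lambda : R) (lambda_gt0 : 0 < lambda)
    (t : R) (t_gt0 : 0 < t)
    (x : 'rV[R]_n) :
  let r := Num.sqrt (6 * sup_norm f) in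
  (forall eps : R, 0 < eps ->
     forall a : R -> 'rV[R]_n, eps_optimal M f lambda x t eps a ->
     forall delta : R, 0 < delta ->
       occupation f lambda t x a delta <=
       lambda / (1 - expR (- (lambda * t))) *
         ((r * edist_set x (argmin_set f) + eps) / delta)) /\
  (forall a : R -> 'rV[R]_n, eps_optimal M f lambda x t 0 a ->
     forall delta : R, 0 < delta ->
       occupation f lambda t x a delta <=
       lambda / (1 - expR (- (lambda * t))) *
         (r * edist_set x (argmin_set f) / delta)).
Proof.
move=> r.
have rM : r <= M by apply: le_trans M_ge; rewrite lerDr.
suff H eps a delta : eps_optimal M f lambda x t eps a -> 0 < delta ->
    occupation f lambda t x a delta <=
    lambda / (1 - expR (- (lambda * t))) *
      ((r * edist_set x (argmin_set f) + eps) / delta).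
  split=> [eps _ a aopt delta d0|a aopt delta d0]; first exact: H.
  by have := H 0 a delta aopt d0; rewrite addr0.
move=> aopt d0; apply: ler_wpM2l.
  by rewrite divr_ge0 ?(ltW lambda_gt0)// subr_ge0 discount_le1// ltW.
rewrite ler_pdivlMr// mulrC; apply: (occupation_time_le _ _ f M) => //; exact: ltW.
Qed.
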